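(* Let $\alpha\in(0,1)$, $\mu>0$, $q=(1+(1-\alpha)\mu)^{-1}$, and let $X$ be a $\mathbb{Z}_+$-valued random variable. Then the conditional probability mass function of $(\alpha,\mu)\star X$ given $X=x$ is $$p_k^{(x)}=P\big((\alpha,\mu)\star X=k\mid X=x\big)=\begin{cases}(1-\alpha q)^{x} & \text{if } k=0,\\[4pt] \displaystyle\sum_{i=1}^{\min(k,x)}A_i^{(x)}(\alpha q)\,B_i^{(k)}(q) & \text{if } k\ge 1.\end{cases}$$
   Context: $\mathbb{Z}_+=\{0,1,2,\dots\}$; pgf means probability generating function. For $\alpha\in(0,1)$ and $\mu>0$, the thinning operator $(\alpha,\mu)\star(\cdot)$ acts on a $\mathbb{Z}_+$-valued random variable $X$ by $(\alpha,\mu)\star X=\sum_{i=1}^{X}G_i$ (empty sum $=0$), where $(G_i)_{i\ge1}$ is an i.i.d. sequence of $\mathbb{Z}_+$-valued random variables, independent of $X$, with common pgf $$\Psi_G(s)=1-\alpha\frac{1-s}{1+(1-\alpha)\mu(1-s)}.$$ For $n\ge1$, $0\le i\le n$, $1\le l\le n$ and $0<y<1$, $$A_i^{(n)}(y)=\binom{n}{i}y^i(1-y)^{n-i},\qquad B_l^{(n)}(y)=\binom{n-1}{l-1}y^l(1-y)^{n-l}.$$ Empty sums are $0$. *)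

(* Defs.v *)
From HB Require Import structures.
From mathcomp Require Import all_boot all_order all_algebra finmap.
From mathcomp Require Import all_classical all_reals all_analysis.
From mathcomp Require Import measurable_realfun.

Set Implicit Arguments.
Unset Strict Implicit.
Unset Printing Implicit Defensive.

Import Order.TTheory GRing.Theory Num.Theory.
Import numFieldNormedType.Exports.
Local Open Scope classical_set_scope.
Local Open Scope ring_scope.

Section Probability.
Context d (T : measurableType d) (R : realType) (P : probability T R).

Definition cond_prob (A B : set T) : R := fine (P (A `&` B)) / fine (P B).

Definition pgf (X : T -> nat) (s : R) : \bar R := 'E_P[fun w => s ^+ X w].

Definition identically_distributed (X : nat -> {RV P >-> nat}) : Prop :=
  forall i j, distribution P (X i) = distribution P (X j) :> (set nat -> \bar R).

Definition mutually_independent (X : nat -> {RV P >-> nat}) : Prop :=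
  forall (J : {fset nat}) (B : nat -> set nat),
    (forall j, measurable (B j)) ->
    P (\bigcap_(j in [set` J]) (X j @^-1` B j))
      = (\prod_(j <- J) P (X j @^-1` B j))%E.

Definition iid (X : nat -> {RV P >-> nat}) : Prop :=
  identically_distributed X /\ mutually_independent X.

Definition sigma_algebra_of (X : T -> nat) : set_system T :=
  preimage_set_system setT X measurable.

Definition sigma_algebra_of_seq (G : nat -> T -> nat) : set_system T :=
  <<s \bigcup_i sigma_algebra_of (G i) >>.

Definition independent_of_seq (X : T -> nat) (G : nat -> T -> nat) : Prop :=
  forall A B : set T, sigma_algebra_of X A -> sigma_algebra_of_seq G B ->
    P (A `&` B) = (P A * P B)%E.

End Probability.

Section Thinning.
Context d (T : measurableType d) (R : realType) (P : probability T R).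

Definition PsiG (alpha mu s : R) : R :=
  1 - alpha * ((1 - s) / (1 + (1 - alpha) * mu * (1 - s))).

(* The summands are indexed from 0: [G i] is the (i+1)-st one. *)
Definition thinning_seq (alpha mu : R)
    (X : {RV P >-> nat}) (G : nat -> {RV P >-> nat}) : Prop :=
  [/\ iid G, independent_of_seq P X (fun i => G i) &
      forall i (s : R), 0 <= s <= 1 -> pgf P (G i) s = (PsiG alpha mu s)%:E].

(* [thin X G] is (alpha, mu) * X whenever [thinning_seq alpha mu X G]; the
   parameters enter only through the law of the summands. *)
Definition thin (X : {RV P >-> nat}) (G : nat -> {RV P >-> nat}) : T -> nat :=
  fun w => (\sum_(i < X w) G i w)%N.

Lemma measurable_thin X G : measurable_fun setT (thin X G).
Proof.
have mS n : measurable_fun setT (fun w => (\sum_(i < n) G i w)%N).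
  elim: n => [|n IHn].
    under eq_fun do rewrite big_ord0.
    exact: measurable_cst.
  under eq_fun do rewrite big_ord_recr /=.
  apply: (measurable_fun_addn IHn); exact: measurable_funPT.
move=> _ A mA; rewrite setTI.
have -> : thin X G @^-1` A = \bigcup_n (X @^-1` [set n] `&`
    (fun w => (\sum_(i < n) G i w)%N) @^-1` A).
  apply/seteqP; split=> [w Aw|w [n _ [/= <-]]//].
  by exists (X w).
apply: bigcupT_measurable => n; apply: measurableI.
  exact: measurable_funPTI.
by rewrite -[X in measurable X]setTI; apply: mS.
Qed.

HB.instance Definition _ X G :=
  isMeasurableFun.Build _ _ _ _ (thin X G) (measurable_thin X G).

End Thinning.

Definition binA (R : realType) (n i : nat) (y : R) : R :=
  'C(n, i)%:R * y ^+ i * (1 - y) ^+ (n - i).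

Definition binB (R : realType) (n l : nat) (y : R) : R :=
  'C(n.-1, l.-1)%:R * y ^+ l * (1 - y) ^+ (n - l).

(* Main.v *)
(** Dividing numerator and denominator by 1 + (1 - alpha) mu turns the pgf of
    the summands into 1 - p + p (q s / (1 - (1 - q) s)) with p = alpha q: a
    summand is 0 with probability 1 - p and otherwise geometric on {1, 2, ...}
    with success probability q. Among x independent summands the number i of
    nonzero ones is binomial (the A's), and a sum of i geometric variables is
    negative binomial (the B's). Since X is independent of the summands,
    conditioning on X = x amounts to fixing the number of summands. *)

Require Import Defs.
From mathcomp Require Import all_boot all_order all_algebra finmap.
From mathcomp Require Import all_classical all_reals all_analysis.
From mathcomp Require Import measurable_realfun.
From mathcomp Require Import ring lra.

Import Order.TTheory GRing.Theory Num.Theory.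
Local Open Scope classical_set_scope.
Local Open Scope ring_scope.

(** * Convolution powers of the zero-modified geometric law *)

Fixpoint convpow (R : realType) (g : nat -> R) (n k : nat) : R :=
  if n is m.+1 then \sum_(j < k.+1) convpow R g m (k - j)%N * g j
  else (k == 0%N)%:R.
Arguments convpow {R}.

Definition zero_mod_geom {R : realType} (p q : R) (k : nat) : R :=
  if k is j.+1 then p * (q * (1 - q) ^+ j) else 1 - p.

(* The law of a sum of [i] geometric variables. The cases [i = 0] and [k = 0]
   are separate because truncated subtraction makes [binB] nonzero there, e.g.
   [binB 0 1 q = q] and [binB 1 0 q = 1 - q]. *)
Definition negbin {R : realType} (q : R) (i k : nat) : R :=
  if i == 0%N then (k == 0%N)%:R else if k == 0%N then 0 else binB k i q.

Section Compound.
Context {R : realType}.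
Implicit Types (p q : R) (i k n : nat).

Lemma binAS n i p :
  binA n.+1 i.+1 p = (1 - p) * binA n i.+1 p + p * binA n i p.
Proof.
rewrite /binA binS natrD subSS.
have [ltin|leni] := ltnP i n; last first.
  by rewrite (@bin_small n i.+1)// exprS; ring.
by rewrite -(subnSK ltin) !exprS; ring.
Qed.

(** Condition on the first Bernoulli trial: a failure uses up one trial, a success also lowers the
    number of successes still awaited. *)
Lemma negbinSS q i k :
  negbin q i.+1 k.+1 = (1 - q) * negbin q i.+1 k + q * negbin q i k.
Proof.
rewrite /negbin /binB /=.
case: i => [|i]; case: k => [|k] //=.
- by rewrite bin0; ring.
- by rewrite !bin0 !subSS !subn0 !exprS; ring.
- by rewrite bin_small//; ring.
rewrite binS natrD !subSS.
have [ltik|leki] := ltnP i k; last first.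
  by rewrite (@bin_small k)// !exprS; ring.
by rewrite -(subnSK ltik) !exprS; ring.
Qed.

Lemma sum_geom_conv q (f : nat -> R) k :
  \sum_(j < k.+1) q * (1 - q) ^+ j * f (k - j)%N =
  q * f k + (1 - q) * \sum_(j < k) q * (1 - q) ^+ j * f (k - j.+1)%N.
Proof.
rewrite big_ord_recl/= subn0; congr (_ + _); first by ring.
by rewrite mulr_sumr; apply: eq_bigr => j _; rewrite /bump/= add1n ?exprS; ring.
Qed.

(** Adding one geometric variable, of value [j.+1], raises the negative binomial index by one. In
    the induction on [k], splitting off [j = 0] yields the recursion [negbinSS]. *)
Lemma negbin_conv (a : nat -> R) q n k :
  \sum_(j < k) q * (1 - q) ^+ j *
     \sum_(i < n) a i * negbin q i (k - j.+1)%N =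
  \sum_(i < n) a i * negbin q i.+1 k.
Proof.
elim: k => [|k IHk].
  by rewrite big_ord0 big1// => i _; rewrite /negbin mulr0.
under eq_bigr do rewrite subSS.
rewrite (sum_geom_conv q (fun m => \sum_(i < n) a i * negbin q i m)) IHk.
rewrite !mulr_sumr -big_split/=.
by apply: eq_bigr => i _; rewrite negbinSS; ring.
Qed.

(** Induction on [n]: a new summand is zero and keeps [i], or is geometric and raises [i] by one;
    Pascal's rule [binAS] merges the two cases. *)
Lemma convpow_zero_mod_geom p q n k :
  convpow (zero_mod_geom p q) n k =
  \sum_(i < n.+1) binA n i p * negbin q i k.
Proof.
elim: n k => [|n IHn] k.
  by rewrite big_ord1 /binA/= /negbin/= bin0; ring.
rewrite [LHS]/=; under eq_bigr do rewrite IHn.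
rewrite big_ord_recl/= subn0.
have -> : \sum_(j < k) (\sum_(i < n.+1) binA n i p *
      negbin q i (k - bump 0 j)%N) * (p * (q * (1 - q) ^+ j)) =
    p * \sum_(i < n.+1) binA n i p * negbin q i.+1 k.
  rewrite -(negbin_conv (fun i => binA n i p)) mulr_sumr.
  by apply: eq_bigr => j _; rewrite /bump/= add1n ?exprS; ring.
rewrite [RHS]big_ord_recl/=.
have binASM i : binA n.+1 (bump 0 i) p * negbin q (bump 0 i) k =
    (1 - p) * (binA n i.+1 p * negbin q i.+1 k) +
    p * (binA n i p * negbin q i.+1 k).
  by rewrite /bump/= add1n binAS; ring.
under [in RHS]eq_bigr do rewrite binASM.
rewrite big_split/= -!mulr_sumr addrA; congr (_ + _).
have -> : binA n.+1 0 p = (1 - p) * binA n 0 p.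
  by rewrite /binA !bin0 !subn0 exprS; ring.
rewrite [LHS]mulrC -mulrA -mulrDr; congr (_ * _).
(* The shifted sum reaches index [n.+1], where the binomial weight vanishes. *)
have An : binA n n.+1 p = 0 by rewrite /binA bin_small// !mul0r.
by rewrite [in RHS]big_ord_recr/= An mul0r addr0 big_ord_recl.
Qed.

(** The term [i = 0] contributes only to [k = 0]; for [k > 0] the terms with [i > k] vanish, which
    cuts the range at [minn k n]. *)
Lemma sum_binA_negbin p q n k :
  \sum_(i < n.+1) binA n i p * negbin q i k =
  if k == 0%N then (1 - p) ^+ n
  else \sum_(1 <= i < (minn k n).+1) binA n i p * binB k i q.
Proof.
case: ifPn => [/eqP ->|k0].
  rewrite big_ord_recl big1 => [|i _]; last by rewrite /negbin mulr0.
  by rewrite /negbin/= /binA bin0 subn0; ring.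
rewrite big_ord_recl/= {1}/negbin/= (negbTE k0) mulr0 add0r.
rewrite big_add1/= big_mkord.
rewrite (big_ord_widen _ (fun i => binA n i.+1 p * binB k i.+1 q)
  (geq_minr k n)).
rewrite [RHS]big_mkcond/=; apply: eq_bigr => i _.
rewrite /bump/= add1n /negbin/= (negbTE k0) ltn_min ltn_ord andbT.
case: ltnP => // leki; rewrite /binB bin_small ?mul0r ?mulr0//=.
by rewrite prednK// lt0n.
Qed.

(** * Power series expansion of the pgf and uniqueness of coefficients *)

Lemma sum_zero_mod_geom p q s n : 1 - (1 - q) * s != 0 ->
  1 - p * ((1 - s) / (1 - (1 - q) * s)) =
  \sum_(k < n.+1) zero_mod_geom p q k * s ^+ k +
  s ^+ n.+1 * (p * (q * (1 - q) ^+ n / (1 - (1 - q) * s))).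
Proof.
move=> D0; elim: n => [|n IHn].
  by rewrite big_ord1 /=; field.
rewrite IHn [in RHS]big_ord_recr/= -addrA; congr (_ + _).
by rewrite !exprS; field.
Qed.

(* A power series is determined near 0: compare the two expansions at the
   first index where they differ and let [s] tend to 0. *)
Lemma eq_coef_of_tail_bounds (F : R -> R) (a b : nat -> R) :
  (forall n s, 0 < s < 1 ->
    0 <= F s - \sum_(k < n.+1) a k * s ^+ k <= s ^+ n.+1) ->
  (forall n s, 0 < s < 1 ->
    0 <= F s - \sum_(k < n.+1) b k * s ^+ k <= s ^+ n.+1) ->
  a =1 b.
Proof.
move=> Fa Fb n; elim/ltn_ind: n => n IHn.
have ab s : 0 < s < 1 -> `|a n - b n| <= s.
  move=> s01; have /andP[s0 s1] := s01.
  move: (Fa n s s01) (Fb n s s01); rewrite !big_ord_recr/= exprS.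
  have -> : \sum_(i < n) a i * s ^+ i = \sum_(i < n) b i * s ^+ i.
    by apply: eq_bigr => i _; rewrite IHn.
  set t := \sum_(i < n) _; move=> /andP[a1 a2] /andP[b1 b2].
  rewrite -(ler_pM2r (exprn_gt0 n s0)).
  have -> : `|a n - b n| * s ^+ n = `|(a n - b n) * s ^+ n|.
    by rewrite normrM (ger0_norm (exprn_ge0 _ (ltW s0))).
  rewrite ler_norml mulrBl.
  by apply/andP; split; lra.
apply/eqP; rewrite -subr_eq0 -normr_le0; apply/ler_addgt0Pl => e e0.
rewrite addr0; pose m := Num.min e 2^-1.
apply: le_trans (ab m _) _; last by rewrite ge_min lexx.
by rewrite lt_min e0 gt_min/=; apply/andP; split; [lra|apply/orP; right; lra].
Qed.

End Compound.

(** * Partial sums of independent variables *)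

Lemma measurable_partial_sum d (T : measurableType d) (G : nat -> T -> nat) n :
  (forall i, measurable_fun setT (G i)) ->
  measurable_fun setT (fun w => (\sum_(i < n) G i w)%N).
Proof.
move=> mG; elim: n => [|n IHn].
  by under eq_fun do rewrite big_ord0; exact: measurable_cst.
by under eq_fun do rewrite big_ord_recr /=; exact: measurable_fun_addn.
Qed.

(** Partial sums are measurable on [T] re-equipped with the sigma-algebra generated by [G]; this is
    the form in which independence from [X] applies. *)
Lemma sigma_algebra_of_seq_sum d (T : measurableType d) (G : nat -> T -> nat)
    n k :
  sigma_algebra_of_seq G ((fun w => \sum_(i < n) G i w)%N @^-1` [set k]).
Proof.
pose C := \bigcup_i sigma_algebra_of (G i).
have mS : measurable_fun setT
    (fun w : g_sigma_algebraType C => (\sum_(i < n) G i w)%N).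
  apply: (@measurable_partial_sum _ (g_sigma_algebraType C)) => i _ A mA.
  by apply: sub_sigma_algebra; exists i => //; exists A.
by have := mS measurableT [set k] I; rewrite setTI; apply.
Qed.

Section Thinning.
Context {R : realType} {d : measure_display} {T : measurableType d}.
Context {P : probability T R}.

(** Split on the value [j] of the last summand. [D] carries constraints on other variables, and
    [C j] absorbs the new one. *)
Lemma preimage_partial_sumS (G : nat -> T -> nat) n k (C : nat -> set T)
    (D : set T) :
  (forall j, C j = G n @^-1` [set j] `&` D) ->
  (fun w => \sum_(i < n.+1) G i w)%N @^-1` [set k] `&` D =
  \big[setU/set0]_(j < k.+1)
    ((fun w => \sum_(i < n) G i w)%N @^-1` [set (k - j)%N] `&` C j).
Proof.
move=> CE; rewrite -(bigcup_mkord _ (fun j =>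
  (fun w => \sum_(i < n) G i w)%N @^-1` [set (k - j)%N] `&` C j)).
apply/seteqP; split=> w /=.
  move=> [+ Dw]; rewrite big_ord_recr/= => <-.
  exists (G n w); first by rewrite /= ltnS leq_addl.
  by rewrite CE/= addnK.
move=> [j /= ltjk []]; rewrite CE => Sw [/= Gw Dw]; split=> //.
by rewrite big_ord_recr/= Sw Gw subnK.
Qed.

Lemma prob_partial_sum (G : nat -> {RV P >-> nat}) (g : nat -> R) n k :
  mutually_independent G ->
  (forall i j, P (G i @^-1` [set j]) = (g j)%:E) ->
  P ((fun w => \sum_(i < n) G i w)%N @^-1` [set k]) = (convpow g n k)%:E.
Proof.
move=> indG Gg.
have mS m j : measurable ((fun w => \sum_(i < m) G i w)%N @^-1` [set j]).
  have := measurable_partial_sum _ _ _ m (fun i => measurable_funPT (G i)).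
  by move=> /(_ measurableT [set j] I); rewrite setTI.
(* The induction on [n] splits on the value of the last summand, so the
   statement must allow events on the variables of index at least [n]. *)
suff H (J : {fset nat}) (B : nat -> set nat) :
    (forall j, j \in J -> n <= j)%N ->
    P ((fun w => \sum_(i < n) G i w)%N @^-1` [set k] `&`
       \bigcap_(j in [set` J]) (G j @^-1` B j)) =
    ((convpow g n k)%:E * \prod_(j <- J) P (G j @^-1` B j))%E.
  have := H fset0 (fun=> setT); rewrite set_fset0 bigcap_set0 setIT => -> //.
  by rewrite big_seq_fset0 mule1.
elim: n k J B => [|n IHn] k J B leJ.
  rewrite -indG//=; have [->|k0] := eqVneq k 0%N.
    rewrite mul1e; congr (P _); apply/seteqP; split=> [w []//|w Cw].
    by split=> //=; rewrite big_ord0.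
  rewrite mul0e -[RHS](measure0 P); congr (P _).
  apply/seteqP; split=> // w [/=]; rewrite big_ord0 => /esym/eqP.
  by rewrite (negbTE k0).
have nJ : n \notin J by apply/negP => /leJ; rewrite ltnn.
(* The constraint [G n = j] joins those indexed by [J]. *)
pose B' j := fun i => if i == n then [set j] else B i.
have B'E j i : i \in J -> B' j i = B i.
  by rewrite /B'; case: eqP => // ->; rewrite (negbTE nJ).
pose C j := \bigcap_(i in [set` (n |` J)%fset]) (G i @^-1` B' j i).
rewrite (preimage_partial_sumS (fun i => G i) n k C); last first.
  move=> j; rewrite /C bigcap_fsetU1 {1}/B' eqxx; congr (_ `&` _).
  by apply: eq_bigcapr => i /= iJ; rewrite B'E.
rewrite measure_bigsetU_ord; first last.
- apply/trivIsetP => /= i j _ _ ij; rewrite -subset0 => w [[_ Ci] [_ Cj]].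
  apply: (negP ij); apply/eqP/val_inj.
  have nJ' : [set` (n |` J)%fset] n by rewrite /= !inE eqxx.
  by have := Ci _ nJ'; have := Cj _ nJ'; rewrite /B' eqxx /= => -> ->.
- move=> j; apply: measurableI => //.
  by apply: fin_bigcap_measurable => // i _; exact: measurable_funPTI.
(* The product is finite, so the sum over [j] can be computed in [R]. *)
have [c cE] : exists c, (\prod_(j <- J) P (G j @^-1` B j) = c%:E)%E.
  elim/big_ind: _ => [|_ _ [a ->] [b ->]|i _]; first by exists 1.
    by exists (a * b).
  exists (fine (P (G i @^-1` B i))); rewrite fineK// fin_num_measure//.
  exact: measurable_funPTI.
rewrite cE /= -EFinM mulr_suml -sumEFin.
apply: eq_bigr => j _.
rewrite IHn; last first.
  by move=> i; rewrite !inE => /orP[/eqP ->//|/leJ /ltnW].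
rewrite big_fsetU1//= {1}/B' eqxx Gg !EFinM -muleA -cE; congr (_ * (_ * _))%E.
by apply: eq_big_seq => i iJ; rewrite B'E.
Qed.

(** * From the pgf to the probability mass function *)

(** The partial sum is the expectation of [s ^+ X] restricted to [X <= n]; elsewhere [s ^+ X] is at
    most [s ^+ n.+1]. *)
Lemma pgf_bounds (X : {RV P >-> nat}) n (s : R) : 0 < s < 1 ->
  ((\sum_(k < n.+1) fine (P (X @^-1` [set val k])) * s ^+ k)%:E <= pgf P X s <=
  (\sum_(k < n.+1) fine (P (X @^-1` [set val k])) * s ^+ k + s ^+ n.+1)%:E)%E.
Proof.
move=> /andP[s0 s1].
have mX k : measurable (X @^-1` [set k]) by exact: measurable_funPTI.
pose f k w : R := s ^+ k * \1_(X @^-1` [set k]) w.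
have f0 k w : 0 <= f k w by rewrite mulr_ge0 ?exprn_ge0// ltW.
have mf k : measurable_fun setT (f k).
  by apply: measurable_funM; [exact: measurable_cst|exact: measurable_indic].
have Ef : (\int[P]_w (\sum_(k < n.+1) f k w)%:E =
    (\sum_(k < n.+1) fine (P (X @^-1` [set val k])) * s ^+ k)%:E)%E.
  under eq_integral do rewrite -sumEFin.
  rewrite ge0_integral_sum//; last first.
  - by move=> k w _; rewrite lee_fin.
  - by move=> k; exact/measurable_EFinP.
  rewrite -sumEFin; apply: eq_bigr => k _.
  under eq_integral do rewrite EFinM.
  rewrite ge0_integralZl//; last 2 first.
  - by apply/measurable_EFinP; exact: measurable_indic.
  - by rewrite lee_fin exprn_ge0// ltW.
  by rewrite integral_indic// setIT mulrC EFinM fineK ?fin_num_measure.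
have fX w : \sum_(k < n.+1) f k w = if (X w < n.+1)%N then s ^+ X w else 0.
  have fE k : f k w = if X w == k then s ^+ k else 0.
    rewrite /f indicE; case: eqP => [Xk|Xk].
      by rewrite mem_set// mulr1.
    by rewrite memNset// mulr0.
  under eq_bigr do rewrite fE.
  case: ltnP => [ltXn|lenX].
    rewrite (bigD1 (Ordinal ltXn))//= eqxx big1 ?addr0// => i.
    by rewrite -val_eqE/= eq_sym => /negbTE ->.
  by rewrite big1// => i _; rewrite gtn_eqF// (leq_trans _ lenX).
have mpX : measurable_fun setT (fun w => s ^+ X w).
  by apply: (measurableT_comp (f := fun m => s ^+ m)) => //.
have mSf : measurable_fun setT (fun w => \sum_(k < n.+1) f k w).
  exact: measurable_sum.
have Sf0 w : 0 <= \sum_(k < n.+1) f k w by rewrite sumr_ge0.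
rewrite /pgf expectation.unlock EFinD -Ef; apply/andP; split.
  apply: ge0_le_integral => //.
  - by move=> w _; rewrite lee_fin.
  - exact/measurable_EFinP.
  - exact/measurable_EFinP.
  move=> w _; rewrite lee_fin fX; case: ifP => // _.
  by rewrite exprn_ge0// ltW.
have -> : (s ^+ n.+1)%:E = (\int[P]_w (s ^+ n.+1)%:E)%E.
  by rewrite integral_cst// [X in _ = (_ * X)%E]probability_setT mule1.
rewrite -ge0_integralD//; first last.
- by move=> w _; rewrite lee_fin exprn_ge0// ltW.
- exact/measurable_EFinP.
- by move=> w _; rewrite lee_fin.
apply: ge0_le_integral => //.
- by move=> w _; rewrite lee_fin exprn_ge0// ltW.
- exact/measurable_EFinP.
- by apply/measurable_EFinP; apply: measurable_funD.
move=> w _; rewrite -EFinD lee_fin fX; case: ltnP => [_|lenX].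
  by rewrite lerDl exprn_ge0// ltW.
by rewrite add0r ler_wiXn2l// ltW.
Qed.

(** Both mass functions satisfy the tail bounds for [PsiG], hence coincide. *)
Lemma pmf_of_pgf_PsiG (alpha mu : R) (X : {RV P >-> nat}) (k : nat) :
  0 < alpha < 1 -> 0 < mu ->
  (forall s, 0 <= s <= 1 -> pgf P X s = (PsiG alpha mu s)%:E) ->
  let q := (1 + (1 - alpha) * mu)^-1 in
  P (X @^-1` [set k]) = (zero_mod_geom (alpha * q) q k)%:E.
Proof.
move=> /andP[alpha0 alpha1] mu0 XPsi q.
have c0 : 0 < (1 - alpha) * mu by rewrite mulr_gt0// subr_gt0.
have q0 : 0 < q by rewrite invr_gt0; lra.
have q1 : q <= 1 by rewrite invf_le1; lra.
have mX j : measurable (X @^-1` [set j]) by exact: measurable_funPTI.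
rewrite -[LHS]fineK ?fin_num_measure//; congr (_%:E).
apply: (eq_coef_of_tail_bounds (PsiG alpha mu)
  (fun j => fine (P (X @^-1` [set j]))) (zero_mod_geom (alpha * q) q))
  => n s s01; have /andP[s0 s1] := s01.
  have := pgf_bounds X n s s01.
  rewrite XPsi; last by rewrite !ltW.
  by rewrite !lee_fin => /andP[lo up]; apply/andP; split; lra.
(* This makes the denominator positive and keeps the remainder factor at most 1. *)
have qD : q <= 1 - (1 - q) * s.
  by have : 0 <= (1 - q) * (1 - s) by [apply: mulr_ge0; lra]; lra.
have D0 : 0 < 1 - (1 - q) * s by lra.
have -> : PsiG alpha mu s =
    1 - alpha * q * ((1 - s) / (1 - (1 - q) * s)).
  rewrite /PsiG; congr (1 - _).
  (* Substitute [(1 - alpha) * mu = q^-1 - 1]. *)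
  have E : 1 + (1 - alpha) * mu * (1 - s) = (1 - (1 - q) * s) / q.
    by rewrite /q; field; lra.
  by rewrite E; field; rewrite !gt_eqF.
rewrite (sum_zero_mod_geom _ _ _ n) ?gt_eqF// [X in X - _]addrC addrK.
have r0 : 0 <= 1 - q by lra.
have w0 : 0 <= q * (1 - q) ^+ n / (1 - (1 - q) * s).
  by rewrite divr_ge0 ?mulr_ge0 ?exprn_ge0// ltW.
have w1 : q * (1 - q) ^+ n / (1 - (1 - q) * s) <= 1.
  rewrite ler_pdivrMr// mul1r (le_trans _ qD)// ler_piMr ?(ltW q0)//.
  by rewrite exprn_ile1//; lra.
have sn0 : 0 <= s ^+ n.+1 by rewrite exprn_ge0// ltW.
have aq0 : 0 <= alpha * q by rewrite mulr_ge0// ltW.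
have aq1 : alpha * q <= 1 by rewrite mulr_ile1// ltW.
apply/andP; split; first exact: mulr_ge0 sn0 (mulr_ge0 aq0 w0).
by apply: ler_piMr => //; apply: mulr_ile1.
Qed.

End Thinning.

(** * The conditional law of the thinned variable *)

Theorem lemma3p1 (R : realType) (d : measure_display) (T : measurableType d)
    (P : probability T R) (alpha mu : R)
    (X : {RV P >-> nat}) (G : nat -> {RV P >-> nat}) :
  0 < alpha < 1 -> 0 < mu -> thinning_seq alpha mu X G ->
  let q := (1 + (1 - alpha) * mu)^-1 in
  forall x : nat, P (X @^-1` [set x]) != 0%E ->
  forall k : nat,
    cond_prob P (thin X G @^-1` [set k]) (X @^-1` [set x]) =
    if k == 0%N then (1 - alpha * q) ^+ x
    else \sum_(1 <= i < (minn k x).+1) binA x i (alpha * q) * binB k i q.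
Proof.
move=> alpha01 mu0 [[_ indG] indXG GPsi] q x Px k.
rewrite /cond_prob.
(* On [X = x] the number of summands is fixed, so the second event depends on [G] alone and
   independence applies. *)
have -> : thin X G @^-1` [set k] `&` X @^-1` [set x] =
    X @^-1` [set x] `&` (fun w => \sum_(i < x) G i w)%N @^-1` [set k].
  rewrite setIC; apply/seteqP.
  by split=> w [/= <-].
rewrite indXG; first last.
- exact: sigma_algebra_of_seq_sum.
- by exists [set x] => //; rewrite setTI.
have Gpmf i j := pmf_of_pgf_PsiG alpha mu (G i) j alpha01 mu0 (GPsi i).
rewrite (prob_partial_sum _ _ _ _ indG Gpmf) -/q.
have PxE : P (X @^-1` [set x]) = (fine (P (X @^-1` [set x])))%:E.
  by rewrite fineK// fin_num_measure//; exact: measurable_funPTI.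
rewrite fineM//; last by rewrite PxE.
rewrite mulrC mulKf//=; last by apply: contra_neq Px => Px; rewrite PxE Px.
by rewrite convpow_zero_mod_geom sum_binA_negbin.
Qed.
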